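(* Let $p>0$, $\epsilon>0$, $0<\mu,\sigma\ll 1$, $\beta_1\in(0,1)$, and let $g_1,g_2,\dots$ be i.i.d. with $g_t\sim\mathrm{Unif}(\mu-\sigma,\mu+\sigma)$. Define $$u:=\lim_{t\to\infty}\lim_{\beta_2\to1}u_t,\qquad u_t=\frac{m_t}{\sqrt{v_t}+\epsilon},$$ where $m_t=\mathrm{EMA}_{\beta_1}(\{g_s^p\}_{s=1}^t)$ and $v_t=\mathrm{EMA}_{\beta_2}(\{(g_s^p)^2\}_{s=1}^t)$. In the high-noise regime $\mu\ll\sigma$, it holds that $$u=\frac{\mu}{\sigma}\cdot\frac{1+o(1)}{\frac{1}{\sqrt{2p+1}}+\frac{\epsilon}{\sigma^p}}\quad\text{almost surely}.$$ Moreover, let $\tilde u=\frac{\mu}{\sigma}\cdot\frac{1}{\frac{1}{\sqrt{2p+1}}+\frac{\epsilon}{\sigma^p}}$, viewed as a function of $p$. If $\epsilon\log(1/\sigma)<1$, then there exists an optimal power $p^\star$ such that $\tilde u$ increases for $0<p<p^\star$ and decreases for $p>p^\star$; and there is the tight estimate $$p^\star=\Theta\left(\frac{\log(\epsilon\log(1/\sigma))}{\log\sigma}\right).$$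
   Context: For $g\in\mathbb{R}$ and $p>0$, $g^p$ denotes the sign-power $|g|^p\,\mathrm{sign}(g)$. For a sequence $\{a_s\}$ and $\beta\in(0,1)$, the exponential moving average is $\mathrm{EMA}_\beta(\{a_s\}_{s=1}^t)=\big(\sum_{s=1}^t\beta^{t-s}a_s\big)/\big(\sum_{s=1}^t\beta^{t-s}\big)$. $u_t$ is the update of the AdamWPower optimizer (AdamW, with zero weight decay, fed with the transformed gradients $g_t^p$) on a one-dimensional problem with stochastic gradients $g_t$; $\epsilon$ is Adam's numerical stability parameter. $o(1)$ denotes an infinitesimal quantity as $\mu/\sigma\to0$, and $\Theta(\cdot)$ hides problem-independent constants.
   Formalization: For fixed β1 the limit u almost surely does not exist; the formal theorem instead proves the formula for the limit of time averages of lim_{β2→1} u_t (β1 fixed), and for the ordinary limit t→∞ with (β1,β2)→(1,1) jointly. The Θ constants are uniform for σ ≤ σ0, any σ0<1. *)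

(* Defs.v *)
From HB Require Import structures.
From mathcomp Require Import all_boot all_order all_algebra.
From mathcomp Require Import all_classical all_reals all_analysis.

Set Implicit Arguments.
Unset Strict Implicit.
Unset Printing Implicit Defensive.

Import Order.TTheory GRing.Theory Num.Theory.
Import numFieldNormedType.Exports.

Local Open Scope classical_set_scope.
Local Open Scope ring_scope.

Definition sign_pow (R : realType) (p x : R) : R := Num.sg x * `|x| `^ p.

(* Sequences are indexed by t = 1, 2, ...; the value [a 0] is never used. *)
Definition ema (R : realType) (beta : R) (a : nat -> R) (t : nat) : R :=
  (\sum_(1 <= s < t.+1) beta ^+ (t - s) * a s) /
  (\sum_(1 <= s < t.+1) beta ^+ (t - s)).

Definition adamw_power_update (R : realType) (beta1 beta2 p eps : R)
    (g : nat -> R) (t : nat) : R :=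
  let m := ema beta1 (fun s => sign_pow p (g s)) t in
  let v := ema beta2 (fun s => sign_pow p (g s) ^+ 2) t in
  m / (Num.sqrt v + eps).

Definition utilde (R : realType) (mu sigma eps p : R) : R :=
  mu / sigma * (1 / (1 / Num.sqrt (2 * p + 1) + eps / sigma `^ p)).

Definition mutually_independent d (T : measurableType d) (R : realType)
    (P : probability T R) (X : nat -> {RV P >-> R}) : Prop :=
  forall (s : seq nat) (A : nat -> set R),
    uniq s -> (forall i, measurable (A i)) ->
    P (\bigcap_(i in [set` s]) (X i @^-1` A i)) =
    (\prod_(i <- s) P (X i @^-1` A i))%E.

Definition uniform_law d (T : measurableType d) (R : realType)
    (P : probability T R) (X : {RV P >-> R}) (a b : R) : Prop :=
  exists ab : a < b, forall A : set R, measurable A ->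
    distribution P X A = uniform_prob ab A.

Definition iid_uniform d (T : measurableType d) (R : realType)
    (P : probability T R) (X : nat -> {RV P >-> R}) (a b : R) : Prop :=
  mutually_independent X /\ forall t, uniform_law (X t) a b.

(* For fixed beta1 < 1, w_t := lim_{beta2 -> 1} u_t diverges almost surely as
   t -> oo: (1 - beta1^t) m_t - beta1 (1 - beta1^(t-1)) m_(t-1) equals
   (1 - beta1) g_t^p, so convergence of m_t would force the nondegenerate i.i.d.
   sequence g_t^p to converge.  The outer limit is hence taken either (i) in the
   sense of time averages, with beta1 fixed, or (ii) as an ordinary limit, with
   beta1 sent to 1 together with beta2. *)
Definition mean_iterated_limit (R : realType) (beta1 p eps : R)
    (g : nat -> R) (u : R) : Prop :=
  exists w : nat -> R,
    (forall t, (0 < t)%N ->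
       adamw_power_update beta1 beta2 p eps g t @[beta2 --> 1^'-] --> w t) /\
    arithmetic_mean (fun t => w t.+1) @ \oo --> u.

Definition joint_iterated_limit (R : realType) (p eps : R)
    (g : nat -> R) (u : R) : Prop :=
  exists w : nat -> R,
    (forall t, (0 < t)%N ->
       adamw_power_update beta.1 beta.2 p eps g t
         @[beta --> ((1 : R)^'-, (1 : R)^'-)] --> w t) /\
    w @ \oo --> u.

(* Main.v *)
(* Idea.  Since [beta2 -> 1] turns the second-moment average into a plain mean,
   the strong law of large numbers gives [v -> E[g^(2p)]] almost surely.  The
   first-moment average has the same Cesaro limit as its input: its unnormalised
   numerator satisfies [N t.+1 = beta N t + a t.+1], so that
   [(1 - beta) \sum_t N t] differs from [\sum_t a t] by a bounded amount.  Hence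
   [u = E[g^p] / (sqrt E[g^(2p)] + eps)].  For [mu < sigma] the moments are
   explicit: by the mean value theorem [E[g^p] = mu c^p / sigma] for some [c]
   within [mu] of [sigma], while [E[g^(2p)] = sigma^(2p) (1 + o(1)) / (2p + 1)].

   For the optimal power, put [L = ln (1 / sigma)].  The derivative in [p] of the
   denominator [(2p + 1)^(-1/2) + eps exp (p L)] has the sign of the increasing
   function [ln (eps L) + p L + 3/2 ln (2p + 1)], whose zero [p*] satisfies
   [p* L <= - ln (eps L) <= p* (L + 3)] because [0 <= ln (1 + 2p) <= 2p]. *)

Require Import Defs.
From HB Require Import structures.
From mathcomp Require Import all_boot all_order all_algebra.
From mathcomp Require Import all_classical all_reals all_analysis.
From mathcomp Require Import measurable_realfun zify lra ring.

Import Order.TTheory GRing.Theory Num.Theory.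
Import numFieldNormedType.Exports.

Local Open Scope classical_set_scope.
Local Open Scope ring_scope.

Set Implicit Arguments.
Unset Strict Implicit.

(** * The optimal power *)

(** The denominator of [utilde] with [L = ln (1 / sigma)], written with exponentials so that the two
    terms of its derivative can be compared through their exponents. *)
Definition update_denominator (R : realType) (eps L p : R) : R :=
  expR (- 2^-1 * ln (2 * p + 1)) + eps * expR (p * L).

(* The logarithm of the ratio of the two terms of the derivative of
   [update_denominator]. *)
Definition slope_sign (R : realType) (eps L p : R) : R :=
  ln (eps * L) + p * L + 3 / 2 * ln (2 * p + 1).

Lemma is_derive_affine (R : realType) (a b x : R) :
  is_derive x (1 : R) (fun y : R => a * y + b) a.
Proof.
have -> : (fun y : R => a * y + b) = (a \*: (@id R)) + cst b by apply/funext.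
apply: is_derive_eq.
by rewrite addr0 /GRing.scale /= mulr1.
Qed.

Lemma is_derive_update_denominator (R : realType) (eps L p : R) : 0 <= p ->
  is_derive p (1 : R) (update_denominator eps L)
    (eps * L * expR (p * L) - (2 * p + 1)^-1 * expR (- 2^-1 * ln (2 * p + 1))).
Proof.
move=> p0; have q0 : 0 < 2 * p + 1 by lra.
have dln : is_derive p (1 : R) (fun y : R => - 2^-1 * ln (2 * y + 1))
    (- 2^-1 * ((2 * p + 1)^-1 * 2)).
  apply: (@is_derive1_comp _ (fun y : R => - 2^-1 * y) (fun y => ln (2 * y + 1))).
    have := is_derive_affine (- 2^-1) 0 (ln (2 * p + 1)).
    by under eq_fun do rewrite addr0.
  exact: (@is_derive1_comp _ (@ln R) (fun y => 2 * y + 1) _ _ _ (is_derive1_ln q0)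
    (is_derive_affine 2 1 p)).
have d1 := @is_derive1_comp _ (@expR R) (fun y => - 2^-1 * ln (2 * y + 1)) _ _ _
  (is_derive_expR _) dln.
have dL : is_derive p (1 : R) (fun y : R => y * L) L.
  have := is_derive_affine L 0 p.
  by under eq_fun do rewrite addr0 mulrC.
have d2 := @is_derive1_comp _ (@expR R) (fun y => y * L) _ _ _ (is_derive_expR _) dL.
have d3 : is_derive p (1 : R) (fun y : R => eps * expR (y * L)) (eps * (expR (p * L) * L)).
  apply: (@is_derive1_comp _ (fun y : R => eps * y) (fun y => expR (y * L))) => //.
  have := is_derive_affine eps 0 (expR (p * L)).
  by under eq_fun do rewrite addr0.
have -> : update_denominator eps L =
  (expR \o (fun y : R => - 2^-1 * ln (2 * y + 1))) + (fun y => eps * expR (y * L)).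
  by apply/funext.
apply: is_derive_eq.
by field; lra.
Qed.

(** Once [eps * L] and [2 * p + 1] are written as exponentials of their logarithms, each term of the
    derivative is a single [expR], and the difference of the two exponents is [slope_sign]. *)
Lemma update_denominator_derive_sign (R : realType) (eps L p : R) :
  0 < eps * L -> 0 <= p ->
  (eps * L * expR (p * L) - (2 * p + 1)^-1 * expR (- 2^-1 * ln (2 * p + 1)) < 0)
    = (slope_sign eps L p < 0) /\
  (0 < eps * L * expR (p * L) - (2 * p + 1)^-1 * expR (- 2^-1 * ln (2 * p + 1)))
    = (0 < slope_sign eps L p).
Proof.
move=> eL0 p0; have q0 : 0 < 2 * p + 1 by lra.
rewrite -[eps * L]lnK ?posrE// -{1 3}[2 * p + 1]lnK ?posrE// -!expRN -!expRD.
by rewrite subr_lt0 subr_gt0 !ltr_expR /slope_sign; split; apply/idP/idP; lra.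
Qed.

Lemma slope_sign_increasing (R : realType) (eps L p q : R) :
  0 < L -> 0 <= p -> p < q -> slope_sign eps L p < slope_sign eps L q.
Proof.
move=> L0 p0 pq; rewrite /slope_sign.
have : ln (2 * p + 1) < ln (2 * q + 1) by rewrite ltr_ln ?posrE; lra.
have : p * L < q * L by rewrite ltr_pM2r.
lra.
Qed.

(** With [K = - ln (eps * L)], [slope_sign] equals [- K] at 0, and at [K / L] its first two summands
    cancel, leaving a nonnegative logarithm. The upper bound on the root is the right end of this
    interval. *)
Lemma slope_sign_root (R : realType) (eps L : R) :
  0 < eps -> 0 < L -> eps * L < 1 ->
  exists p : R, [/\ 0 < p, slope_sign eps L p = 0,
    p <= - ln (eps * L) / L & - ln (eps * L) / (L + 3) <= p].
Proof.
move=> e0 L0 eL1; have eL0 : 0 < eps * L by exact: mulr_gt0.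
pose K := - ln (eps * L); have K0 : 0 < K by rewrite oppr_gt0 ln_lt0// eL0.
have KL0 : 0 < K / L by exact: divr_gt0.
have cont : {within `[0, K / L], continuous (slope_sign eps L)}.
  apply: derivable_within_continuous => x; rewrite in_itv/= => /andP[x0 _].
  have q0 : 0 < 2 * x + 1 by lra.
  apply: derivableD; last first.
    apply: derivableM => //.
    have d := @is_derive1_comp _ (@ln R) (fun y => 2 * y + 1) _ _ _ (is_derive1_ln q0)
      (is_derive_affine 2 1 x).
    exact: (@ex_derive _ _ _ _ _ _ _ d).
  have := is_derive_affine L (ln (eps * L)) x.
  under eq_fun do rewrite addrC [L * _]mulrC.
  by move=> d; apply: (@ex_derive _ _ _ _ _ _ _ d).
have s0 : slope_sign eps L 0 = - K.
  by rewrite /slope_sign mul0r mulr0 add0r ln1 mulr0 !addr0 opprK.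
have sK : 0 <= slope_sign eps L (K / L).
  have : 0 <= ln (2 * (K / L) + 1) by rewrite ln_ge0// lerDr mulr_ge0// ltW.
  rewrite /slope_sign divfK ?gt_eqF// => lnK0.
  by rewrite /K subrr add0r mulr_ge0.
have [|c] := @IVT R (slope_sign eps L) 0 (K / L) 0 (ltW KL0) cont.
  by rewrite ge_min s0 le_max sK orbT andbT oppr_le0 (ltW K0).
rewrite in_itv/= => /andP[c0 cK] sc.
have cpos : 0 < c.
  rewrite lt_neqAle c0 andbT; apply/eqP => c0'; move: sc.
  by rewrite -c0' s0; lra.
exists c; split => //.
rewrite ler_pdivrMr; last lra.
(* Turns [K = c * L + 3 / 2 * ln (1 + 2 * c)] into [K <= c * (L + 3)]. *)
have lnle : ln (1 + 2 * c) <= 2 * c by apply: le_ln1Dx; lra.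
move: sc; rewrite /slope_sign [2 * c + 1]addrC; lra.
Qed.

Lemma utilde_update_denominator (R : realType) (mu sigma eps p : R) :
  0 < sigma -> 0 <= p ->
  utilde mu sigma eps p =
  mu / sigma * (update_denominator eps (ln (1 / sigma)) p)^-1.
Proof.
move=> s0 p0; have q0 : 0 < 2 * p + 1 by lra.
rewrite /utilde /update_denominator !div1r; do 3 f_equal.
  by rewrite -powR12_sqrt ?(ltW q0)// /powR gt_eqF// -expRN mulNr.
by rewrite lnV ?posrE// mulrN expRN /powR gt_eqF.
Qed.

Lemma update_denominator_gt0 (R : realType) (eps L p : R) :
  0 < eps -> 0 < update_denominator eps L p.
Proof. by move=> e0; rewrite addr_gt0 ?mulr_gt0 ?expR_gt0. Qed.

Lemma optimal_power (R : realType) (eps mu sigma : R) :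
  0 < eps -> 0 < mu -> 0 < sigma < 1 -> eps * ln (1 / sigma) < 1 ->
  exists pstar : R,
    [/\ 0 < pstar,
        (forall p q : R, 0 < p -> p < q -> q < pstar ->
           utilde mu sigma eps p < utilde mu sigma eps q),
        (forall p q : R, pstar < p -> p < q ->
           utilde mu sigma eps q < utilde mu sigma eps p),
        pstar <= - ln (eps * ln (1 / sigma)) / ln (1 / sigma) &
        - ln (eps * ln (1 / sigma)) / (ln (1 / sigma) + 3) <= pstar].
Proof.
move=> e0 m0 /andP[s0 s1]; set L := ln (1 / sigma) => eL1.
have L0 : 0 < L by rewrite ln_gt0// div1r invf_gt1.
have eL0 : 0 < eps * L by exact: mulr_gt0.
have [c [c0 sc cle cge]] := slope_sign_root e0 L0 eL1.
have ms0 : 0 < mu / sigma by exact: divr_gt0.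
have dD (x : R) : 0 <= x -> derivable (update_denominator eps L) x 1.
  by move=> x0; apply: (@ex_derive _ _ _ _ _ _ _ (is_derive_update_denominator eps L x0)).
have D'E x : 0 <= x -> derive1 (update_denominator eps L) x = eps * L * expR (x * L) -
    (2 * x + 1)^-1 * expR (- 2^-1 * ln (2 * x + 1)).
  move=> x0; rewrite derive1E.
  exact: (@derive_val _ _ _ _ _ _ _ (is_derive_update_denominator eps L x0)).
exists c; split => //.
- move=> p q p0 pq qc.
  rewrite !utilde_update_denominator -/L ?ltr_pM2l//; try lra.
  rewrite ltf_pV2 ?posrE ?update_denominator_gt0//.
  have cont : {within `[0, c], continuous (update_denominator eps L)}.
    by apply: derivable_within_continuous => x; rewrite in_itv/= => /andP[/dD].
  apply: (ltr0_derive1_lt_cc _ _ cont) => //.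
  + by move=> x; rewrite in_itv/= => /andP[/ltW/dD].
  + move=> x; rewrite in_itv/= => /andP[/ltW x0 xc].
    rewrite D'E// (update_denominator_derive_sign eL0 x0).1 -sc.
    exact: slope_sign_increasing.
  + by rewrite in_itv/=; apply/andP; split; lra.
  + by rewrite in_itv/=; apply/andP; split; lra.
- move=> p q cp pq.
  rewrite !utilde_update_denominator -/L ?ltr_pM2l//; try lra.
  rewrite ltf_pV2 ?posrE ?update_denominator_gt0//.
  have cont : {within `[c, q], continuous (update_denominator eps L)}.
    apply: derivable_within_continuous => x; rewrite in_itv/= => /andP[cx _].
    by apply: dD; lra.
  apply: (gtr0_derive1_lt_cc _ _ cont) => //.
  + by move=> x; rewrite in_itv/= => /andP[cx _]; apply: dD; lra.
  + move=> x; rewrite in_itv/= => /andP[cx xq]; have x0 : 0 <= x by lra.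
    rewrite D'E// (update_denominator_derive_sign eL0 x0).2 -sc.
    by apply: slope_sign_increasing => //; lra.
  + by rewrite in_itv/=; apply/andP; split; lra.
  + by rewrite in_itv/=; apply/andP; split; lra.
Qed.

Lemma optimal_power_bounds (R : realType) (sigma0 : R) : 0 < sigma0 < 1 ->
    exists c C : R, 0 < c /\ 0 < C /\
      forall eps mu sigma : R,
        0 < eps -> 0 < mu < 1 -> 0 < sigma <= sigma0 ->
        eps * ln (1 / sigma) < 1 ->
        exists pstar : R,
          [/\ 0 < pstar,
              (forall p q : R, 0 < p -> p < q -> q < pstar ->
                 utilde mu sigma eps p < utilde mu sigma eps q),
              (forall p q : R, pstar < p -> p < q ->
                 utilde mu sigma eps q < utilde mu sigma eps p) &
              c * (ln (eps * ln (1 / sigma)) / ln sigma) <= pstar <=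
              C * (ln (eps * ln (1 / sigma)) / ln sigma)].
Proof.
move=> /andP[s00 s01]; pose L0 := ln (1 / sigma0).
have L00 : 0 < L0 by rewrite ln_gt0// div1r invf_gt1.
(* With [L = ln (1 / sigma)], the ratio [ln (eps * L) / ln sigma] is [- ln (eps * L) / L], so 1
   serves above. Below, [L / (L + 3)] increases with [L], and [sigma <= sigma0] gives [L0 <= L]. *)
exists (L0 / (L0 + 3)), 1; split; first by rewrite divr_gt0//; lra.
split => // eps mu sigma e0 /andP[m0 _] /andP[s0 ss0] eL1.
have s1 : sigma < 1 by lra.
have [|c [c0 inc dec cle cge]] := optimal_power e0 m0 _ eL1; first by rewrite s0.
exists c; split => //; rewrite [1 * (ln _ / _)]mul1r.
set L := ln (1 / sigma) in cle cge eL1 *.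
have LE : ln sigma = - L by rewrite /L div1r lnV ?posrE// opprK.
have LL0 : L0 <= L.
  by rewrite /L0 /L !div1r ler_ln ?posrE ?invr_gt0// lef_pV2 ?posrE.
rewrite LE invrN mulrN -mulNr cle andbT; apply: le_trans cge.
have K0 : 0 < - ln (eps * L) by rewrite oppr_gt0 ln_lt0// eL1 mulr_gt0//; lra.
rewrite mulrCA ler_pM2l// ler_pdivrMr; last lra.
rewrite [_^-1 * L]mulrC ler_pdivlMr; last lra.
rewrite mulrAC ler_pdivrMr; last lra.
nra.
Qed.

(** * Independence and the strong law *)

Lemma bounded_measurable_integrable d (T : measurableType d) (R : realType)
    (P : probability T R) (f : T -> R) (M : R) :
  measurable_fun setT f -> (forall x, `|f x| <= M) ->
  P.-integrable setT (EFin \o f).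
Proof.
move=> mf fM; apply: measurable_bounded_integrable => //.
  by apply: (le_lt_trans (probability_le1 _ _)) => //; exact: ltry.
exists M; split; first exact: num_real.
by move=> N MN x _ /=; rewrite (le_trans (fM x))// ltW.
Qed.

Arguments bounded_measurable_integrable {d T R P f M}.

(** Independence says that the law of the pair agrees with the product of the two laws on
    rectangles, hence everywhere by uniqueness of the product measure; Fubini then separates the
    factors. *)
Lemma Rintegral_product_independent d (T : measurableType d) (R : realType)
    (P : probability T R) (X Y : {RV P >-> R}) (f g : R -> R) (M N : R) :
  (forall A B, measurable A -> measurable B ->
    P (X @^-1` A `&` Y @^-1` B) = (P (X @^-1` A) * P (Y @^-1` B))%E) ->
  measurable_fun setT f -> measurable_fun setT g ->
  (forall x, `|f x| <= M) -> (forall x, `|g x| <= N) ->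
  \int[P]_w (f (X w) * g (Y w)) = \int[P]_w f (X w) * \int[P]_w g (Y w).
Proof.
move=> indep mf mg fM gN.
pose Z w := (X w, Y w).
have mZ : measurable_fun setT Z by apply/measurable_fun_pairP; split; exact: measurable_funPT.
pose h (z : R * R) := f z.1 * g z.2.
have mh : measurable_fun setT h.
  apply: measurable_funM; first exact: measurableT_comp.
  exact: measurableT_comp.
have hM z : `|h z| <= M * N by rewrite normrM ler_pM.
have intZ : P.-integrable setT ((EFin \o h) \o Z) :=
  bounded_measurable_integrable (measurableT_comp mh mZ) (fun w => hM (Z w)).
have fX : \int[distribution P X]_x f x = \int[P]_w f (X w).
  rewrite /Rintegral integral_distribution//; first exact/measurable_EFinP.
  exact: (bounded_measurable_integrable (measurableT_comp mf (measurable_funPT X)) (fun w => fM (X w))).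
have gY : \int[distribution P Y]_x g x = \int[P]_w g (Y w).
  rewrite /Rintegral integral_distribution//; first exact/measurable_EFinP.
  exact: (bounded_measurable_integrable (measurableT_comp mg (measurable_funPT Y)) (fun w => gN (Y w))).
rewrite -fX -gY.
pose mZ_mixin := isMeasurableFun.Build _ _ _ _ _ mZ.
pose Zm : {mfun T >-> (R * R)%type} := MeasurableFun.Pack (MeasurableFun.Class mZ_mixin).
have prodE (A : set (R * R)) : measurable A ->
    (distribution P X \x distribution P Y)%E A = distribution P Zm A.
  apply: product_measure_unique => B C mB mC.
  by rewrite /distribution /pushforward -indep.
have hprod : (distribution P X \x distribution P Y)%E.-integrable setT (EFin \o h).
  apply: measurable_bounded_integrable => //.
    apply: (eq_ind_r (fun z => z < +oo)%E _ (prodE _ measurableT)).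
    by rewrite (le_lt_trans (probability_le1 _ _)) ?ltry.
  exists (M * N); split; first exact: num_real.
  by move=> K MK x _ /=; rewrite (le_trans (hM x))// ltW.
have -> : \int[P]_w (f (X w) * g (Y w)) =
    \int[(distribution P X \x distribution P Y)%E]_z h z.
  rewrite /Rintegral (@eq_measure_integral _ _ _ _ (distribution P Zm)); last first.
    by move=> A mA _; exact: prodE.
  by rewrite integral_distribution//; exact/measurable_EFinP.
rewrite /Rintegral -integral12_prod_meas1//.
have gi : (distribution P Y).-integrable setT (EFin \o g) :=
  bounded_measurable_integrable mg gN.
have inner x : fubini_F (distribution P Y) (EFin \o h) x =
    (f x * \int[distribution P Y]_y g y)%:E.
  rewrite /fubini_F /h /=; under eq_integral do rewrite EFinM.
  by rewrite integralZl// EFinM fineK//; exact: integrable_fin_num.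
rewrite (eq_integral (fun x => (f x * \int[distribution P Y]_y g y)%:E)).
  exact: (RintegralZr _ _ (bounded_measurable_integrable mf fM)).
by move=> x _; exact: inner.
Qed.

Lemma floor_sqrt_succ (n : nat) : exists k : nat, (k.+1 ^ 2 <= n.+1 < k.+2 ^ 2)%N.
Proof.
elim: n => [|n [k /andP[kn nk]]]; first by exists 0%N.
have [lt_nk|le_kn] := ltnP n.+2 (k.+2 ^ 2); first by exists k; rewrite lt_nk; lia.
by exists k.+1; lia.
Qed.

(** Averages along squares suffice: an index between [k.+1 ^ 2] and [k.+2 ^ 2] adds at most
    [2 * k.+1] bounded terms, negligible against [k.+1 ^ 2]. The hypothesis is squared to match a
    bound on second moments. *)
Lemma arithmetic_mean_cvg0_squares (R : realType) (a : R ^nat) (M : R) :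
  (forall i, `|a i| <= M) ->
  (series a (k.+1 ^ 2)%N / (k.+1 ^ 2)%:R) ^+ 2 @[k --> \oo] --> (0 : R) ->
  arithmetic_mean a @ \oo --> (0 : R).
Proof.
move=> aM /cvgrPdist_lt sq; apply/cvgrPdist_lt => e e0.
have M0 : 0 <= M := le_trans (normr_ge0 _) (aM 0%N).
have e20 : 0 < (e / 2) ^+ 2 by rewrite exprn_gt0// divr_gt0.
have [K1 _ K1P] := sq _ e20.
(* For [k >= K2] this bounds the gap [2 * k.+1 * M] by [e / 2 * k.+1 ^ 2]; the other half of [e]
   pays for the average at the square. *)
have [K2 K2P] : exists K2 : nat, 4 * M / e < K2%:R.
  by exists (Num.bound (4 * M / e)); rewrite archi_boundP// divr_ge0 ?mulr_ge0// ltW.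
exists ((maxn K1 K2).+2 ^ 2)%N => // n /= nK.
have [k /andP[kn nk]] := floor_sqrt_succ n.
have kK : ((maxn K1 K2) <= k)%N by nia.
have k1 : (K1 <= k)%N by lia.
have k2 : (K2 <= k)%N by lia.
rewrite sub0r normrN /arithmetic_mean /= normrM ger0_norm// ltr_pdivrMl//.
have /K1P := k1; rewrite /= sub0r normrN ger0_norm ?sqr_ge0// => sk.
have : `|series a (k.+1 ^ 2)%N / (k.+1 ^ 2)%:R| < e / 2.
  rewrite ltNge; apply/negP => h; move: sk; rewrite -real_normK ?num_real// ltNge.
  by rewrite lerXn2r// nnegrE// ltW// divr_gt0.
rewrite normrM normfV [`|_%:R|]ger0_norm// ltr_pdivrMr ?ltr0n ?expn_gt0// => sk'.
have -> : series a n.+1 = series a (k.+1 ^ 2)%N + \sum_((k.+1 ^ 2)%N <= i < n.+1) a i.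
  by rewrite !seriesEnat /= -big_cat_nat.
apply: le_lt_trans (ler_normD _ _) _.
have gap : `|\sum_((k.+1 ^ 2)%N <= i < n.+1) a i| <= (2 * k.+1)%:R * M.
  apply: le_trans (ler_norm_sum _ _ _) _.
  apply: (@le_trans _ _ (\sum_((k.+1 ^ 2)%N <= i < n.+1) M)); first exact: ler_sum.
  rewrite sumr_const_nat -[M *+ _]mulr_natl ler_wpM2r// ler_nat; nia.
apply: (@lt_le_trans _ _ (e / 2 * (k.+1 ^ 2)%:R + (2 * k.+1)%:R * M)).
  by rewrite ltr_leD.
have kn' : ((k.+1 ^ 2)%:R : R) <= n.+1%:R by rewrite ler_nat.
apply: (@le_trans _ _ (e * (k.+1 ^ 2)%:R)); last by rewrite mulrC ler_wpM2r// ltW.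
have : 4 * M <= e * k.+1%:R.
  move: K2P; rewrite ltr_pdivrMr// => /ltW /le_trans; apply.
  by rewrite mulrC ler_wpM2l ?(ltW e0)// ler_nat; lia.
rewrite natrX natrM => h.
have k0 : 0 <= (k.+1%:R : R) by [].
nra.
Qed.

(** * Strong law for bounded, pairwise orthogonal variables *)

Section strong_law.
Context d (T : measurableType d) (R : realType) (P : probability T R).
Variables (Y : nat -> T -> R) (M : R).
Hypothesis mY : forall n, measurable_fun setT (Y n).
Hypothesis YM : forall n x, `|Y n x| <= M.
Hypothesis Y_uncorrelated :
  forall i j, i != j -> \int[P]_x (Y i x * Y j x) = 0.

Let S n x := series (Y ^~ x) n.

Let measurable_S n : measurable_fun setT (S n).
Proof.
rewrite /S; under eq_fun do rewrite seriesEnat /=.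
exact: measurable_sum.
Qed.

Let S_bound n x : `|S n x| <= n%:R * M.
Proof.
rewrite /S seriesEnat /=; apply: (le_trans (ler_norm_sum _ _ _)).
apply: (@le_trans _ _ (\sum_(0 <= i < n) M)); first exact: ler_sum.
by rewrite sumr_const_nat subn0 -[M *+ _]mulr_natl.
Qed.

Let S_succ n x : S n.+1 x = S n x + Y n x.
Proof. by rewrite /S /series /= big_nat_recr. Qed.

Let S_cross k n : (k <= n)%N -> \int[P]_x (S k x * Y n x) = 0.
Proof.
elim: k => [_|k IHk kn].
  under eq_Rintegral do rewrite /S /series /= big_geq// mul0r.
  by rewrite Rintegral_cst ?mul0r.
under eq_Rintegral do rewrite S_succ mulrDl.
rewrite RintegralD//.
- by rewrite IHk 1?ltnW// Y_uncorrelated ?addr0// ltn_eqF.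
- apply: (@bounded_measurable_integrable _ _ _ _ _ (k%:R * M * M)).
    exact: measurable_funM.
  by move=> x; rewrite normrM ler_pM.
- apply: (@bounded_measurable_integrable _ _ _ _ _ (M * M)).
    exact: measurable_funM.
  by move=> x; rewrite normrM ler_pM.
Qed.

Let S_sq_integrable n : P.-integrable setT (EFin \o (fun x => S n x ^+ 2)).
Proof.
apply: (@bounded_measurable_integrable _ _ _ _ _ ((n%:R * M) ^+ 2)).
  exact: measurable_funX.
by move=> x; rewrite normrX lerXn2r// nnegrE (le_trans _ (S_bound n x)).
Qed.

(** In the expansion of the square of [S n x + Y n x] the cross term integrates to 0 by
    orthogonality, so each new variable adds at most [M ^+ 2]. *)
Let S_second_moment n : \int[P]_x (S n x ^+ 2) <= n%:R * M ^+ 2.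
Proof.
have intM2 : \int[P]_x (cst (M ^+ 2) x) = M ^+ 2.
  by rewrite Rintegral_cst// [X in fine X]probability_setT mulr1.
elim: n => [|n IHn].
  under eq_Rintegral do rewrite /S /series /= big_geq// expr0n/=.
  by rewrite Rintegral_cst// !mul0r.
under eq_Rintegral do rewrite S_succ sqrrD -addrA.
have YY : P.-integrable setT (EFin \o (fun x => Y n x ^+ 2)).
  apply: (@bounded_measurable_integrable _ _ _ _ _ (M ^+ 2)).
    exact: measurable_funX.
  by move=> x; rewrite normrX lerXn2r// nnegrE (le_trans _ (YM n x)).
have SY : P.-integrable setT (EFin \o (fun x => S n x * Y n x)).
  apply: (@bounded_measurable_integrable _ _ _ _ _ (n%:R * M * M)).
    exact: measurable_funM.
  by move=> x; rewrite normrM ler_pM.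
have SY2 : P.-integrable setT (EFin \o (fun x => S n x * Y n x *+ 2)).
  have -> : EFin \o (fun x => S n x * Y n x *+ 2) =
      ((EFin \o (fun x => (S n x * Y n x)%R)) \+ (EFin \o (fun x => (S n x * Y n x)%R)))%E.
    by apply/funext => x; rewrite /= mulr2n EFinD.
  exact: integrableD.
rewrite RintegralD//; last first.
  have -> : EFin \o (fun x => S n x * Y n x *+ 2 + Y n x ^+ 2) =
      ((EFin \o (fun x => (S n x * Y n x *+ 2)%R)) \+ (EFin \o (fun x => (Y n x ^+ 2)%R)))%E.
    by apply/funext.
  exact: integrableD.
rewrite RintegralD//.
under [X in _ + (X + _)]eq_Rintegral do rewrite mulr2n.
rewrite RintegralD// S_cross// !add0r mulrSr mulrDl mul1r lerD// -[leRHS]intM2.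
apply: le_Rintegral => //.
  apply: (@bounded_measurable_integrable _ _ _ _ _ `|M ^+ 2|) => //.
move=> x _ /=; rewrite -[X in X <= _]real_normK ?num_real// lerXn2r// nnegrE.
by rewrite (le_trans _ (YM n x)).
Qed.

(* These have a summable sequence of expectations, hence tend to 0 almost surely. *)
Let avg_sq k x := (S (k.+1 ^ 2)%N x / (k.+1 ^ 2)%:R) ^+ 2.

Let avg_sq_integral k : (\int[P]_x (avg_sq k x)%:E <= (M ^+ 2 * (k.+1%:R ^- 2))%:E)%E.
Proof.
have -> : (\int[P]_x (avg_sq k x)%:E)%E =
    ((k.+1 ^ 2)%:R ^- 2 * \int[P]_x (S (k.+1 ^ 2)%N x ^+ 2))%:E.
  rewrite -RintegralZl// /Rintegral fineK; last first.
    apply: integrable_fin_num => //.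
    exact: (integrableZl measurableT _ (S_sq_integrable (k.+1 ^ 2)%N)).
  by apply: eq_integral => x _; rewrite /avg_sq exprMn exprVn mulrC.
rewrite lee_fin ler_pdivrMl ?exprn_gt0//.
apply: le_trans (S_second_moment _) _.
rewrite natrX -!exprM le_eqVlt; apply/orP; left; apply/eqP; field.
by rewrite nat1r.
Qed.

(** By monotone convergence the series of the [avg_sq k] has finite expectation, so it converges
    almost surely and its terms tend to 0. This is the control along squares that the Cesaro lemma
    asks for. *)
Lemma strong_law_centered :
  {ae P, forall x, arithmetic_mean (Y ^~ x) @ \oo --> (0 : R)}.
Proof.
have mavg k : measurable_fun setT (fun x => (avg_sq k x)%:E).
  apply/measurable_EFinP; apply: measurable_funX; exact: measurable_funM.
have avg0 k x : (0 <= (avg_sq k x)%:E)%E by rewrite lee_fin sqr_ge0.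
have int_lt : (\int[P]_x (\sum_(k <oo) (avg_sq k x)%:E) < +oo)%E.
  rewrite integral_nneseries//.
  apply: (@le_lt_trans _ _ (2 * M ^+ 2)%:E); last exact: ltry.
  apply: lime_le.
    by apply: is_cvg_nneseries => k _ _; exact: integral_ge0.
  apply: nearW => n.
  apply: (@le_trans _ _ (\sum_(0 <= k < n) (M ^+ 2 * k.+1%:R ^- 2)%:E)%E).
    exact: lee_sum.
  rewrite sumEFin lee_fin -mulr_sumr [leRHS]mulrC ler_wpM2l ?sqr_ge0//.
  (* A bound on the sum of the inverse squares that induction can carry: it starts at 0, and its
     increment exceeds the new term by [n / (n.+1 ^ 2 * n.+2)]. *)
  apply: (@le_trans _ _ (2 - 2 / n.+1%:R)); last by rewrite gerBl divr_ge0.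
  elim: n => [|n IHn]; first by rewrite big_geq// divr1 subrr.
  rewrite big_nat_recr//= (le_trans (lerD IHn (lexx _)))//.
  rewrite -subr_ge0.
  have -> : 2 - 2 / n.+2%:R - (2 - 2 / n.+1%:R + n.+1%:R ^- 2) =
      n%:R / (n.+1%:R ^+ 2 * n.+2%:R) :> R.
    rewrite -[n.+2%:R]natr1 -[n.+1%:R]natr1; field.
    have n0 : 0 <= n%:R :> R by [].
    by apply/andP; split; apply: lt0r_neq0; lra.
  by rewrite divr_ge0// mulr_ge0.
have : P.-integrable setT (fun x => \sum_(k <oo) (avg_sq k x)%:E)%E.
  apply/integrableP; split.
    by apply: ge0_emeasurable_sum.
  under eq_integral => x _ do rewrite gee0_abs ?nneseries_ge0//.
  exact: int_lt.
move/(integrable_ae measurableT); apply: filterS => x /(_ I) fin.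
apply: (@arithmetic_mean_cvg0_squares _ _ M) => //.
change ((fun k => avg_sq k x) @ \oo --> (0 : R)).
apply: cvg_series_cvg_0.
apply: nondecreasing_is_cvgn.
  apply/nondecreasing_seqP => n; rewrite /series /= big_nat_recr//= lerDl sqr_ge0//.
exists (fine (\sum_(k <oo) (avg_sq k x)%:E)%E) => _ [n _ <-].
rewrite -lee_fin fineK// -sumEFin.
exact: nneseries_lim_ge.
Qed.

End strong_law.

Lemma mutually_independent_pair d (T : measurableType d) (R : realType)
    (P : probability T R) (X : nat -> {RV P >-> R}) (i j : nat) (A B : set R) :
  mutually_independent X -> i != j -> measurable A -> measurable B ->
  P (X i @^-1` A `&` X j @^-1` B) = (P (X i @^-1` A) * P (X j @^-1` B))%E.
Proof.
move=> indep ij mA mB.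
have := indep [:: i; j] (fun k => if k == i then A else B).
rewrite /= inE ij /= !big_cons big_nil eqxx eq_sym (negbTE ij) mule1 => <- //; last first.
  by move=> k; case: ifP.
congr (P _); apply/seteqP; split => x /=.
  by move=> [Ax Bx] k /=; rewrite !inE => /orP[/eqP ->|/eqP ->];
    rewrite ?eqxx// eq_sym (negbTE ij).
move=> h; split; first by have := h i; rewrite /= !inE !eqxx; apply.
by have := h j; rewrite /= !inE !eqxx orbT eq_sym (negbTE ij); apply.
Qed.

(** The centred variables [f (X n) - m] are orthogonal, since independence factors the integral of a
    product of two of them into zero means. Adding [m] back shifts the averages by [m]. *)
Lemma strong_law_iid d (T : measurableType d) (R : realType)
    (P : probability T R) (X : nat -> {RV P >-> R}) (f : R -> R) (M m : R) :
  mutually_independent X -> measurable_fun setT f -> (forall x, `|f x| <= M) ->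
  (forall n, \int[P]_w f (X n w) = m) ->
  {ae P, forall x, arithmetic_mean (fun n => f (X n x)) @ \oo --> m}.
Proof.
move=> indep mf fM meanf.
pose h y := f y - m.
have mh : measurable_fun setT h by exact: measurable_funB.
have hM y : `|h y| <= M + `|m| by rewrite (le_trans (ler_normB _ _))// lerD2r.
have mean0 n : \int[P]_w h (X n w) = 0.
  rewrite /h RintegralD//; last 2 first.
  - exact: (bounded_measurable_integrable (measurableT_comp mf (measurable_funPT (X n)))
      (fun w => fM (X n w))).
  - exact: (@bounded_measurable_integrable _ _ _ P (cst (- m)) `|- m|).
  rewrite meanf Rintegral_cst// [X in fine X]probability_setT mulr1 subrr//.
have : {ae P, forall x, arithmetic_mean (fun n => h (X n x)) @ \oo --> (0 : R)}.
  apply: (@strong_law_centered _ _ _ P (fun n x => h (X n x)) (M + `|m|)) => //.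
  - by move=> n; exact: (measurableT_comp mh (measurable_funPT (X n))).
  - move=> i j ij.
    rewrite (@Rintegral_product_independent _ _ _ P (X i) (X j) h h _ _ _ mh mh hM hM).
      by rewrite !mean0 mul0r.
    by move=> A B; exact: mutually_independent_pair.
apply: filterS => x hx.
rewrite (_ : (fun n => f (X n x)) = (fun n => h (X n x)) \+ cst m); last first.
  by apply/funext => n; rewrite /h /= subrK.
rewrite -[m in _ --> m]add0r.
have -> : arithmetic_mean ((fun n => h (X n x)) \+ cst m) =
   arithmetic_mean (fun n => h (X n x)) \+ cst m.
  apply/funext => n; rewrite /arithmetic_mean /series /= big_split/= mulrDr.
  by rewrite sumr_const_nat subn0 -[m *+ _]mulr_natl mulKf.
by apply: cvgD => //; exact: cvg_cst.
Qed.

(** * Exponential moving averages *)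

Lemma arithmetic_meanD (R : realType) (a b : R ^nat) :
  arithmetic_mean (fun n => a n + b n) = arithmetic_mean a \+ arithmetic_mean b.
Proof.
by apply/funext => n; rewrite /arithmetic_mean /series /= big_split/= mulrDr.
Qed.

Lemma arithmetic_meanZ (R : realType) (c : R) (a : R ^nat) :
  arithmetic_mean (fun n => c * a n) = (fun n => c * arithmetic_mean a n).
Proof.
by apply/funext => n; rewrite /arithmetic_mean /series /= -mulr_sumr mulrCA.
Qed.

Lemma cvg0_bounded_mul (R : realType) (a b : R ^nat) (M : R) :
  (forall n, `|a n| <= M) -> b @ \oo --> (0 : R) ->
  (fun n => a n * b n) @ \oo --> (0 : R).
Proof.
move=> aM b0; apply/norm_cvg0P.
apply: (@squeeze_cvgr _ _ _ _ (cst 0) (fun n => M * `|b n|)).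
- by apply: nearW => n /=; rewrite normr_ge0/= normrM ler_wpM2r.
- exact: cvg_cst.
- rewrite -[X in _ --> X](mulr0 M); apply: cvgMr.
  exact/norm_cvg0P.
Qed.

(** Here [m] converges only in mean while [r] converges outright. Splitting off [l * m n] leaves
    [m n * (r n - l)], which tends to 0 and therefore has means tending to 0. *)
Lemma arithmetic_mean_mul_cvg (R : realType) (m r : R ^nat) (M A l : R) :
  (forall n, `|m n| <= M) -> arithmetic_mean m @ \oo --> A -> r @ \oo --> l ->
  arithmetic_mean (fun n => m n * r n) @ \oo --> A * l.
Proof.
move=> mM mA rl.
have -> : (fun n => m n * r n) = (fun n => l * m n + m n * (r n - l)).
  by apply/funext => n; rewrite mulrBr addrCA [l * _]mulrC subrr addr0.
rewrite arithmetic_meanD arithmetic_meanZ -[A * l]addr0; apply: cvgD.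
  by rewrite mulrC; exact: cvgMr.
apply/cesaro/(cvg0_bounded_mul mM).
by rewrite -(subrr l); apply: cvgB => //; exact: cvg_cst.
Qed.

Section exponential_moving_average.
Context (R : realType) (beta : R).
Hypothesis beta01 : 0 < beta < 1.
Variables (a : R ^nat) (M : R).
Hypothesis aM : forall s, `|a s.+1| <= M.

Let numer t := \sum_(1 <= s < t.+1) beta ^+ (t - s) * a s.
Let denom t := \sum_(1 <= s < t.+1) beta ^+ (t - s).

Let recurrence (b : R ^nat) t : \sum_(1 <= s < t.+2) beta ^+ (t.+1 - s) * b s =
  beta * (\sum_(1 <= s < t.+1) beta ^+ (t - s) * b s) + b t.+1.
Proof.
rewrite big_nat_recr//= subnn mul1r; congr (_ + _).
rewrite mulr_sumr [LHS]big_nat [RHS]big_nat; apply: eq_bigr => s /andP[_ st].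
by rewrite mulrA -exprS subSn.
Qed.

Let denomE t : (1 - beta) * denom t = 1 - beta ^+ t.
Proof.
elim: t => [|t IHt]; first by rewrite /denom big_geq// mulr0 expr0 subrr.
(* The denominator is the numerator of the constant sequence 1, so the same recurrence applies to
   it. *)
have dE u : denom u = \sum_(1 <= s < u.+1) beta ^+ (u - s) * cst 1 s.
  by apply: eq_bigr => s _; rewrite mulr1.
rewrite dE recurrence -dE.
by rewrite exprS mulrDr mulrCA IHt /=; ring.
Qed.

Let denom_gt0 t : (0 < t)%N -> 0 < denom t.
Proof.
case/andP: beta01 => b0 b1 t0.
have b1' : 0 < 1 - beta by rewrite subr_gt0.
by rewrite -(pmulr_rgt0 _ b1') denomE subr_gt0 exprn_ilt1// -?lt0n// ltW.
Qed.

Let numer_le t : `|numer t| <= M * denom t.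
Proof.
case/andP: beta01 => b0 b1.
rewrite (le_trans (ler_norm_sum _ _ _))// mulr_sumr !big_nat.
apply: ler_sum => -[//|s] _.
by rewrite normrM mulrC ler_pM// ger0_norm// exprn_ge0// ltW.
Qed.

Lemma ema_bounded t : (0 < t)%N -> `|ema beta a t| <= M.
Proof.
move=> t0; rewrite /ema normrM normfV [`|denom t|]gtr0_norm ?denom_gt0//.
by rewrite ler_pdivrMr ?denom_gt0//; exact: numer_le.
Qed.

(** Summing the recurrence over [t < n] shifts the sum of the numerators by one index, at the cost
    of the boundary term [numer n], because [numer 0 = 0]. *)
Let sum_numer n : (1 - beta) * (\sum_(0 <= t < n) numer t.+1) =
  \sum_(0 <= t < n) a t.+1 - beta * numer n.
Proof.
elim: n => [|n IHn]; first by rewrite /numer !big_geq// !mulr0 subrr.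
rewrite !big_nat_recr//= mulrDr IHn.
have -> : numer n.+1 = beta * numer n + a n.+1 by exact: recurrence.
ring.
Qed.

Lemma arithmetic_mean_ema (A : R) :
  arithmetic_mean (fun n => a n.+1) @ \oo --> A ->
  arithmetic_mean (fun n => ema beta a n.+1) @ \oo --> A.
Proof.
case/andP: beta01 => b0 b1 aA.
have M0 : 0 <= M := le_trans (normr_ge0 _) (aM 0%N).
have b1' : 0 < 1 - beta by rewrite subr_gt0.
(* Multiplies the quotient by [1 = (1 - beta) * denom n.+1 + beta ^+ n.+1]: the denominator cancels
   in the first part and the second part decays geometrically. *)
have -> : (fun n => ema beta a n.+1) =
    (fun n => (1 - beta) * numer n.+1 + ema beta a n.+1 * beta ^+ n.+1).
  apply/funext => n; rewrite /ema -/(numer _) -/(denom _).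
  have d0 := lt0r_neq0 (denom_gt0 (ltn0Sn n)).
  have := denomE n.+1; move: (beta ^+ n.+1) => z zE.
  have -> : z = 1 - (1 - beta) * denom n.+1 by rewrite zE; ring.
  by field.
rewrite arithmetic_meanD -[A]addr0; apply: cvgD; last first.
  apply/cesaro/(@cvg0_bounded_mul _ _ _ M) => [n|]; first exact: ema_bounded.
  rewrite (cvg_shiftS (fun n => beta ^+ n)).
  by apply: cvg_expr; rewrite gtr0_norm.
have -> : arithmetic_mean (fun n => (1 - beta) * numer n.+1) =
    (fun n => arithmetic_mean (fun n => a n.+1) n + (- beta * numer n.+1) * n.+1%:R^-1).
  apply/funext => n; rewrite arithmetic_meanZ /arithmetic_mean /= !seriesEnat/=.
  by rewrite mulrCA sum_numer mulrBr [_^-1 * (beta * _)]mulrC mulNr mulNr.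
rewrite -[A]addr0; apply: cvgD => //.
(* The boundary term stays bounded because [denom] never exceeds the full geometric sum
   [(1 - beta)^-1]. *)
apply: (@cvg0_bounded_mul _ _ _ (M / (1 - beta))) => [n|]; last exact: cvg_harmonic.
rewrite normrM normrN (gtr0_norm b0).
apply: (@le_trans _ _ (1 * (M / (1 - beta)))); last by rewrite mul1r.
apply: ler_pM; [exact: ltW|by []|exact: ltW|].
rewrite (le_trans (numer_le _))// ler_wpM2l//.
by rewrite -[leRHS]mul1r ler_pdivlMr// mulrC denomE gerBl exprn_ge0// ltW.
Qed.

End exponential_moving_average.

(** For fixed [t] there are finitely many weights and each tends to 1. The indices match because
    [arithmetic_mean] at [t] averages [t.+1] terms. *)
Lemma ema_cvg1 (R : realType) (a : R ^nat) (t : nat) :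
  ema beta a t.+1 @[beta --> (1 : R)^'-] --> arithmetic_mean (fun n => a n.+1) t.
Proof.
have bX k : beta ^+ k @[beta --> (1 : R)^'-] --> (1 : R).
  rewrite -[X in _ --> X](expr1n R k); apply: cvg_at_left_filter.
  exact: exprn_continuous.
rewrite /arithmetic_mean /= mulrC /series /= -[X in X / _](big_add1 _ _ 0%N t.+2 predT).
have addc : continuous (fun z : R * R => z.1 + z.2).
  by move=> z; apply: cvgD; [exact: cvg_fst|exact: cvg_snd].
rewrite /ema; apply: cvgM.
  apply: (cvg_big addc) => s _.
  rewrite -[X in _ --> X]mul1r; apply: cvgM; first exact: bX.
  exact: cvg_cst.
apply: cvgV => //.
have -> : t.+1%:R = \sum_(1 <= s < t.+2) 1 :> R.
  by rewrite sumr_const_nat subSS subn0.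
by apply: (cvg_big addc) => s _; exact: bX.
Qed.

(** * Limits of the update along a fixed sample path *)

Section iterated_limits.
Context (R : realType) (p eps : R) (g : R ^nat) (M A V : R).
Hypothesis eps_gt0 : 0 < eps.
Hypothesis V_ge0 : 0 <= V.
Hypothesis gM : forall s, `|sign_pow p (g s.+1)| <= M.
Hypothesis mean_cvg : arithmetic_mean (fun n => sign_pow p (g n.+1)) @ \oo --> A.
Hypothesis sq_mean_cvg :
  arithmetic_mean (fun n => sign_pow p (g n.+1) ^+ 2) @ \oo --> V.

Let avg_sq := arithmetic_mean (fun n => sign_pow p (g n.+1) ^+ 2).

Let denom_neq0 (v : R) : Num.sqrt v + eps != 0.
Proof. by rewrite gt_eqF// ltr_wpDl. Qed.

Let denom_cvg (T : Type) (F : set_system T) (FF : Filter F) (v : T -> R) (l : R) :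
  v @ F --> l -> (Num.sqrt (v x) + eps)^-1 @[x --> F] --> (Num.sqrt l + eps)^-1.
Proof.
move=> vl; apply: cvgV; first exact: denom_neq0.
apply: cvgD; last exact: cvg_cst.
by apply: continuous_cvg => //; exact: sqrt_continuous.
Qed.

(** The inner limit changes only the second moment, into a plain mean. The result is a bounded
    factor that converges in mean times a reciprocal that converges outright. *)
Lemma mean_iterated_limit_averages (beta1 : R) : 0 < beta1 < 1 ->
  mean_iterated_limit beta1 p eps g (A / (Num.sqrt V + eps)).
Proof.
move=> b01.
exists (fun t => ema beta1 (fun s => sign_pow p (g s)) t / (Num.sqrt (avg_sq t.-1) + eps)).
split => [[//|t] _|].
  rewrite /adamw_power_update; apply: cvgM; first exact: cvg_cst.
  by apply: denom_cvg; exact: ema_cvg1.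
apply: (@arithmetic_mean_mul_cvg _ _ _ M).
- by move=> n; exact: ema_bounded.
- exact: (arithmetic_mean_ema b01 gM).
- exact: denom_cvg.
Qed.

Lemma joint_iterated_limit_averages :
  joint_iterated_limit p eps g (A / (Num.sqrt V + eps)).
Proof.
exists (fun t => arithmetic_mean (fun n => sign_pow p (g n.+1)) t.-1 /
  (Num.sqrt (avg_sq t.-1) + eps)).
split => [[//|t] _|].
  rewrite /adamw_power_update; apply: cvgM.
    apply: (cvg_comp fst (fun b => ema b _ _)); last exact: ema_cvg1.
    (* The projection of the product filter is the left filter at 1: a neighbourhood [B] pulls back
       to the rectangle of [B] and [setT]. *)
    by move=> B HB; exists (B, setT) => [|[x y] []//]; split => //; exact: filterT.
  apply: denom_cvg.
  apply: (cvg_comp snd (fun b => ema b _ _)); last exact: ema_cvg1.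
  by move=> B HB; exists (setT, B) => [|[x y] []//]; split => //; exact: filterT.
rewrite -cvg_shiftS /=.
by apply: cvgM => //; exact: denom_cvg.
Qed.

End iterated_limits.

(** * Moments of the uniform law *)

Lemma continuous_norm_powR (R : realType) (q : R) : 0 < q ->
  continuous (fun x : R => `|x| `^ q).
Proof.
move=> q0 x; have [->|x0] := eqVneq x 0.
  apply/cvgrPdist_lt => e e0; rewrite normr0 powR0 ?gt_eqF//.
  near=> y; rewrite sub0r normrN ger0_norm ?powR_ge0//.
  have -> : e = (e `^ q^-1) `^ q by rewrite -powRrM mulVf ?gt_eqF// powRr1// ltW.
  rewrite gt0_ltr_powR// ?nnegrE ?powR_ge0//.
  by near: y; apply: (@nbhs0_lt R R); exact: powR_gt0.
apply: (@continuous_comp _ _ _ (fun y : R => `|y|) (fun y => y `^ q)).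
  exact: norm_continuous.
apply: differentiable_continuous; apply/derivable1_diffP.
by apply: derivable_powR; rewrite in_itv/= andbT normr_gt0.
Unshelve. all: by end_near. Qed.

(** The odd antiderivative of the even function given by the [q]-th power of the absolute value, in
    one formula for both signs. *)
Definition norm_powR_primitive (R : realType) (q x : R) : R :=
  x * `|x| `^ q / (q + 1).

Lemma continuous_norm_powR_primitive (R : realType) (q : R) : 0 < q ->
  continuous (norm_powR_primitive q).
Proof.
move=> q0 x; apply: cvgMl; apply: cvgM; first exact: cvg_id.
exact: continuous_norm_powR.
Qed.

Lemma norm_powR_primitive_gt0 (R : realType) (q x : R) : 0 < x ->
  norm_powR_primitive q x = x `^ (q + 1) / (q + 1).
Proof.
move=> x0; rewrite /norm_powR_primitive gtr0_norm// addrC powRD.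
  by rewrite powRr1// ltW.
by rewrite (gt_eqF x0) implybT.
Qed.

Lemma norm_powR_primitiveN (R : realType) (q x : R) :
  norm_powR_primitive q (- x) = - norm_powR_primitive q x.
Proof. by rewrite /norm_powR_primitive normrN !mulNr. Qed.

(** On the positive side this is the derivative of a power. The negative side follows by oddness,
    conjugating with [z] to [- 1 * z + 0]. *)
Lemma is_derive_norm_powR_primitive (R : realType) (q x : R) : 0 < q -> x != 0 ->
  is_derive x (1 : R) (norm_powR_primitive q) (`|x| `^ q).
Proof.
move=> q0; have q1 : q + 1 != 0 by rewrite gt_eqF// addr_gt0.
have pos (y : R) : 0 < y -> is_derive y (1 : R) (norm_powR_primitive q) (`|y| `^ q).
  move=> y0.
  have := @is_derive1_powR _ (q + 1) y y0; rewrite addrK => dp.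
  have d : is_derive y (1 : R) (fun z : R => (q + 1)^-1 * z `^ (q + 1)) (`|y| `^ q).
    apply: is_derive_eq; rewrite /GRing.scale /= mulrA mulVf// mul1r gtr0_norm//.
  apply: (near_eq_is_derive _ d).
  near=> z; rewrite norm_powR_primitive_gt0 1?mulrC//.
  by near: z; exact: lt_nbhsr.
rewrite neq_lt => /orP[x0|/pos//].
have Nx0 : 0 < - x by rewrite oppr_gt0.
have dN : is_derive x (1 : R) (fun z : R => - 1 * z + 0) (- 1) by exact: is_derive_affine.
have dF : is_derive (- 1 * x + 0 : R) (1 : R) (norm_powR_primitive q) (`|x| `^ q).
  by rewrite addr0 mulN1r -normrN; exact: pos.
have := @is_derive1_comp _ _ _ _ _ _ (is_derive_affine (- 1) 0 _)
  (@is_derive1_comp _ (norm_powR_primitive q) (fun z => - 1 * z + 0) _ _ _ dF dN).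
rewrite mulrN1 mulN1r opprK; congr (is_derive _ _ _ _).
apply/funext => z.
by rewrite /= !addr0 !mulN1r norm_powR_primitiveN opprK.
Unshelve. all: by end_near. Qed.

Section norm_powR_integral.
Context (R : realType) (q a b : R).
Hypotheses (q_gt0 : 0 < q) (ab : a < b).
Hypothesis ab0 : (b <= 0) || (0 <= a).

(** The fundamental theorem of calculus, on an interval whose interior avoids 0, where the
    derivative of the primitive has been computed. *)
Lemma Rintegral_norm_powR :
  \int[lebesgue_measure]_(x in `[a, b]) (`|x| `^ q) =
  norm_powR_primitive q b - norm_powR_primitive q a.
Proof.
have F x : x \in `]a, b[%R -> is_derive x (1 : R) (norm_powR_primitive q) (`|x| `^ q).
  rewrite in_itv/= => /andP[ax xb]; apply: is_derive_norm_powR_primitive => //.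
  case/orP: ab0 => h; first by rewrite lt_eqF// (lt_le_trans xb).
  by rewrite gt_eqF// (le_lt_trans h).
rewrite /Rintegral (@continuous_FTC2 _ _ (norm_powR_primitive q))//.
- exact/continuous_subspaceT/continuous_norm_powR.
- split.
  + by move=> x /F d; exact: (@ex_derive _ _ _ _ _ _ _ d).
  + exact/cvg_at_right_filter/continuous_norm_powR_primitive.
  + exact/cvg_at_left_filter/continuous_norm_powR_primitive.
- by move=> x /F d; rewrite derive1E; exact: (@derive_val _ _ _ _ _ _ _ d).
Qed.

End norm_powR_integral.

(** The integrand may follow different formulas on the two sides of 0; agreement with [u] is asked
    only on the half-open interval because the point 0 is null. *)
Lemma Rintegral_split0 (R : realType) (a b : R) (f u v : R -> R) :
  a < 0 < b -> lebesgue_measure.-integrable `[a, b] (EFin \o f) ->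
  (forall x, a <= x <= 0 -> f x = v x) -> (forall x, 0 < x <= b -> f x = u x) ->
  lebesgue_measure.-integrable `[0, b] (EFin \o u) ->
  \int[lebesgue_measure]_(x in `[a, b]) f x =
  \int[lebesgue_measure]_(x in `[a, 0]) v x + \int[lebesgue_measure]_(x in `[0, b]) u x.
Proof.
move=> /andP[a0 b0] fi fv fu ui.
have := @Rintegral_itvB _ f (BLeft a) (BRight b) 0 fi.
rewrite !bnd_simp => /(_ (ltW a0) (ltW b0)) h.
have -> : \int[lebesgue_measure]_(x in `[a, 0]) v x = \int[lebesgue_measure]_(x in `[a, 0]) f x.
  by apply: eq_Rintegral => x; rewrite inE/= in_itv/= => /fv ->.
rewrite -(@Rintegral_itv_obnd_cbnd _ 0 (BRight b) u); last first.
  by apply: (integrableS _ _ _ ui) => //; apply: subset_itvr; rewrite bnd_simp.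
have -> : \int[lebesgue_measure]_(x in `]0, b]) u x = \int[lebesgue_measure]_(x in `]0, b]) f x.
  by apply: eq_Rintegral => x; rewrite inE/= in_itv/= => /fu ->.
by rewrite -h addrC subrK.
Qed.

Lemma bounded_measurable_integrable_itv (R : realType) (f : R -> R) (a b M : R) :
  measurable_fun setT f -> (forall x, a <= x <= b -> `|f x| <= M) ->
  lebesgue_measure.-integrable `[a, b] (EFin \o f).
Proof.
move=> mf fM; apply: measurable_bounded_integrable => //.
- by rewrite /= lebesgue_measure_itv/=; case: ifPn => // _; rewrite -EFinD ltry.
- exact: measurable_funTS.
exists M; split; first exact: num_real.
move=> N MN x; rewrite /= in_itv/= => xab.
by rewrite (le_trans (fM x xab))// ltW.
Qed.

Lemma Rintegral_uniform_law d (T : measurableType d) (R : realType)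
    (P : probability T R) (X : {RV P >-> R}) (a b : R) (f : R -> R) (M : R) :
  uniform_law X a b -> measurable_fun setT f -> (forall x, `|f x| <= M) ->
  \int[P]_w f (X w) = (b - a)^-1 * \int[lebesgue_measure]_(x in `[a, b]) f x.
Proof.
move=> [ab unif] mf fM.
have ba0 : b - a != 0 by rewrite gt_eqF// subr_gt0.
have fi : lebesgue_measure.-integrable `[a, b] (EFin \o f).
  by apply: (bounded_measurable_integrable_itv mf) => x _; exact: fM.
have Mi : lebesgue_measure.-integrable `[a, b] (EFin \o cst M).
  by apply: (@bounded_measurable_integrable_itv _ (cst M) _ _ `|M|).
have mf' : @measurable_fun _ _ (measurableTypeR R) (measurableTypeR R) setT f := mf.
have -> : \int[P]_w f (X w) = \int[uniform_prob ab]_x f x.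
  (* [uniform_prob] is a measure on [measurableTypeR R], whose measurable structure
     is not convertible to the one of [R], although the measurable sets are. *)
  have mX : @measurable_fun _ _ T (measurableTypeR R) setT X := measurable_funPT X.
  pose X' : {mfun T >-> measurableTypeR R} :=
    MeasurableFun.Pack (MeasurableFun.Class (isMeasurableFun.Build _ _ _ _ _ mX)).
  transitivity (\int[distribution P X']_x f x).
    rewrite /Rintegral integral_distribution//; first exact/measurable_EFinP.
    exact: (bounded_measurable_integrable (measurableT_comp mf' mX) (fun w => fM (X w))).
  rewrite /Rintegral; congr fine.
  apply: (@eq_measure_integral _ (measurableTypeR R) R setT (uniform_prob ab)
    (distribution P X') (EFin \o f)) => A mA _.
  exact: unif.
(* [integral_uniform] only applies to nonnegative functions. *)
have shift : \int[uniform_prob ab]_x (f x + M) =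
    (b - a)^-1 * \int[lebesgue_measure]_(x in `[a, b]) (f x + M).
  rewrite /Rintegral integral_uniform.
  - rewrite -[X in (_ * X)%E]fineK; first by rewrite -EFinM.
    apply: integrable_fin_num => //.
    apply: (@bounded_measurable_integrable_itv _ (fun x => f x + M) _ _ (M + `|M|)).
      exact: measurable_funD.
    by move=> x _; rewrite (le_trans (ler_normD _ _))// lerD2r.
  - by apply/measurable_EFinP; exact: measurable_funD.
  - by move=> x; rewrite lee_fin -lerBlDr sub0r; have := fM x; rewrite ler_norml => /andP[].
(* The added constant integrates to [M] under the law and averages to [M] over the interval, so it
   cancels. *)
move: shift; rewrite RintegralD//; last 2 first.
- exact: (@bounded_measurable_integrable _ (measurableTypeR R) _ _ _ _ mf' fM).
- exact: (@bounded_measurable_integrable _ _ _ _ (cst M) `|M|).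
rewrite RintegralD// !Rintegral_cst// [X in fine X]probability_setT /= mulr1.
rewrite lebesgue_measure_itv/= lte_fin ab -EFinB/= mulrDr [M * _]mulrC mulKf//.
exact: addIr.
Qed.

Lemma uniform_law_ae_itv d (T : measurableType d) (R : realType)
    (P : probability T R) (X : {RV P >-> R}) (a b : R) :
  uniform_law X a b -> {ae P, forall x, a <= X x <= b}.
Proof.
move=> [ab unif]; exists (X @^-1` (~` `[a, b])); split.
- by rewrite -[X in measurable X]setTI; apply: measurable_funPT => //; exact: measurableC.
- rewrite -[LHS]/(distribution P X _) unif; last exact: measurableC.
  rewrite /uniform_prob integral_uniform_pdf setICl integral_set0//.
- by move=> x /=; rewrite in_itv.
Qed.

(* Agrees with [sign_pow p] on the support of the law, but is bounded everywhere. *)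
Definition truncated_sign_pow (R : realType) (p a b x : R) : R :=
  if a <= x <= b then sign_pow p x else 0.

Lemma measurable_sign_pow (R : realType) (p : R) : 0 < p ->
  measurable_fun setT (@sign_pow R p).
Proof.
move=> p0.
(* This form is a product of measurable functions; at 0 both sides vanish. *)
have -> : @sign_pow R p = (fun x => x * `|x| `^ (p - 1)).
  apply/funext => x.
  by rewrite /sign_pow -(mulr_powRB1 (normr_ge0 x) p0) mulrA -numEsg.
apply: measurable_funM => //.
exact: (measurableT_comp (measurable_powR _) (@normr_measurable _ setT)).
Qed.

Lemma measurable_truncated_sign_pow (R : realType) (p a b : R) : 0 < p ->
  measurable_fun setT (truncated_sign_pow p a b).
Proof.
move=> p0; apply: measurable_fun_ifT => //; last exact: measurable_sign_pow.
by apply: measurable_and; exact: measurable_fun_ler.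
Qed.

Lemma norm_sign_pow_le (R : realType) (p x : R) : `|sign_pow p x| <= `|x| `^ p.
Proof.
rewrite /sign_pow normrM [X in _ * X]ger0_norm ?powR_ge0//.
by rewrite ler_piMl ?powR_ge0// normr_sg; case: (x != 0).
Qed.

Lemma truncated_sign_pow_bounded (R : realType) (p a b x : R) : 0 < p ->
  `|truncated_sign_pow p a b x| <= (`|a| + `|b|) `^ p.
Proof.
move=> p0; rewrite /truncated_sign_pow; case: ifPn => [/andP[ax xb]|_]; last first.
  by rewrite normr0 powR_ge0.
rewrite (le_trans (norm_sign_pow_le _ _))//.
apply: ge0_ler_powR; rewrite ?nnegrE ?addr_ge0 ?(ltW p0)//.
have := ler_norm b; have := ler_norm (- a); rewrite normrN.
have := normr_ge0 a; have := normr_ge0 b.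
by rewrite ler_norml; lra.
Qed.

(** The sign power is minus the even power left of 0 and plus it right of 0. The two halves
    therefore partly cancel, whereas they add up for the square. *)
Lemma Rintegral_truncated_sign_pow (R : realType) (p a b : R) : 0 < p -> a < 0 < b ->
  \int[lebesgue_measure]_(x in `[a, b]) truncated_sign_pow p a b x =
  norm_powR_primitive p b - norm_powR_primitive p (- a).
Proof.
move=> p0 /andP[a0 b0].
have ui c : lebesgue_measure.-integrable `[0, c] (EFin \o (fun x : R => `|x| `^ p)).
  apply: continuous_compact_integrable; first exact: segment_compact.
  exact/continuous_subspaceT/continuous_norm_powR.
have vi : lebesgue_measure.-integrable `[a, 0] (EFin \o (fun x : R => `|x| `^ p)).
  apply: continuous_compact_integrable; first exact: segment_compact.
  exact/continuous_subspaceT/continuous_norm_powR.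
rewrite (@Rintegral_split0 _ _ _ _ (fun x => `|x| `^ p) (fun x => (- 1) * `|x| `^ p)).
- rewrite RintegralZl// !Rintegral_norm_powR ?lexx ?orbT//.
  rewrite norm_powR_primitiveN /norm_powR_primitive !mul0r; ring.
- by rewrite a0.
- apply: (@bounded_measurable_integrable_itv _ _ _ _ ((`|a| + `|b|) `^ p)).
    exact: measurable_truncated_sign_pow.
  by move=> x _; exact: truncated_sign_pow_bounded.
- move=> x /andP[ax x0]; rewrite /truncated_sign_pow ax (le_trans x0 (ltW b0))/=.
  move: x0; rewrite /sign_pow le_eqVlt => /predU1P[->|x0]; last by rewrite ltr0_sg.
  by rewrite sgr0 normr0 powR0 ?gt_eqF// mul0r mulr0.
- move=> x /andP[x0 xb]; rewrite /truncated_sign_pow xb (le_trans (ltW a0) (ltW x0))/=.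
  by rewrite /sign_pow gtr0_sg// mul1r.
- exact: ui.
Qed.

Lemma Rintegral_truncated_sign_pow_sq (R : realType) (p a b : R) : 0 < p -> a < 0 < b ->
  \int[lebesgue_measure]_(x in `[a, b]) truncated_sign_pow p a b x ^+ 2 =
  norm_powR_primitive (2 * p) b + norm_powR_primitive (2 * p) (- a).
Proof.
move=> p0 /andP[a0 b0]; have p20 : 0 < 2 * p by rewrite mulr_gt0.
have sqE (x : R) : sign_pow p x ^+ 2 = `|x| `^ (2 * p).
  rewrite /sign_pow; have [->|x0] := eqVneq x 0.
    by rewrite sgr0 mul0r expr0n normr0 powR0// gt_eqF.
  by rewrite exprMn sqr_sg x0 mul1r mulrC powRrM powR_mulrn// powR_ge0.
rewrite (@Rintegral_split0 _ _ _ _ (fun x => `|x| `^ (2 * p)) (fun x => `|x| `^ (2 * p))).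
- rewrite !Rintegral_norm_powR ?lexx ?orbT//.
  by rewrite norm_powR_primitiveN /norm_powR_primitive !mul0r; ring.
- by rewrite a0.
- apply: (@bounded_measurable_integrable_itv _ _ _ _ (((`|a| + `|b|) `^ p) ^+ 2)).
    by apply: measurable_funX; exact: measurable_truncated_sign_pow.
  move=> x _; rewrite normrX lerXn2r// ?nnegrE ?powR_ge0//.
  exact: truncated_sign_pow_bounded.
- by move=> x /andP[ax x0]; rewrite /truncated_sign_pow ax (le_trans x0 (ltW b0))/= sqE.
- move=> x /andP[x0 xb].
  by rewrite /truncated_sign_pow xb (le_trans (ltW a0) (ltW x0))/= sqE.
- apply: continuous_compact_integrable; first exact: segment_compact.
  exact/continuous_subspaceT/continuous_norm_powR.
Qed.

(** * The limit and its asymptotics *)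

(** The exact first moment of the sign power under the uniform law. It stays an integral because the
    almost sure limit holds for every [a < b], while the closed form is derived for [a < 0 < b]. *)
Definition mean_sign_pow (R : realType) (p a b : R) : R :=
  (b - a)^-1 * \int[lebesgue_measure]_(x in `[a, b]) truncated_sign_pow p a b x.

Definition mean_sign_pow_sq (R : realType) (p a b : R) : R :=
  (b - a)^-1 * \int[lebesgue_measure]_(x in `[a, b]) truncated_sign_pow p a b x ^+ 2.

(** The strong law applies to the bounded truncation and to its square. Almost surely all the
    countably many samples lie in the interval, and there truncation changes nothing. *)
Lemma almost_sure_limits d (T : measurableType d) (R : realType)
    (P : probability T R) (g : nat -> {RV P >-> R}) (p eps a b : R) :
  0 < p -> 0 < eps -> a < b -> iid_uniform (fun t => g t.+1) a b ->
  let u := mean_sign_pow p a b / (Num.sqrt (mean_sign_pow_sq p a b) + eps) in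
  (forall beta1 : R, 0 < beta1 < 1 ->
    {ae P, forall x, mean_iterated_limit beta1 p eps (fun t => g t x) u}) /\
  {ae P, forall x, joint_iterated_limit p eps (fun t => g t x) u}.
Proof.
move=> p0 e0 ab [indep unif] u.
pose f := truncated_sign_pow p a b; pose M := (`|a| + `|b|) `^ p.
have mf : measurable_fun setT f by exact: measurable_truncated_sign_pow.
have fM x : `|f x| <= M by exact: truncated_sign_pow_bounded.
have mf2 : measurable_fun setT (fun x => f x ^+ 2) by exact: measurable_funX.
have f2M x : `|f x ^+ 2| <= M ^+ 2 by rewrite normrX lerXn2r// nnegrE powR_ge0.
have V0 : 0 <= mean_sign_pow_sq p a b.
  rewrite mulr_ge0 ?invr_ge0 ?subr_ge0 ?(ltW ab)//.
  by apply: Rintegral_ge0 => x _; exact: sqr_ge0.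
have good : {ae P, forall x,
    (forall n, `|sign_pow p (g n.+1 x)| <= M) /\
    arithmetic_mean (fun n => sign_pow p (g n.+1 x)) @ \oo --> mean_sign_pow p a b /\
    arithmetic_mean (fun n => sign_pow p (g n.+1 x) ^+ 2) @ \oo
      --> mean_sign_pow_sq p a b}.
  have lln1 := strong_law_iid indep mf fM
    (fun n => Rintegral_uniform_law (unif n) mf fM).
  have lln2 := strong_law_iid indep mf2 f2M
    (fun n => Rintegral_uniform_law (unif n) mf2 f2M).
  have itv := ae_foralln (fun n => uniform_law_ae_itv (unif n)).
  apply: filterS3 lln1 lln2 itv => x h1 h2 h3.
  have fE n : f (g n.+1 x) = sign_pow p (g n.+1 x) by rewrite /f /truncated_sign_pow h3.
  split; first by move=> n; rewrite -fE.
  have E1 : (fun n => f (g n.+1 x)) = (fun n => sign_pow p (g n.+1 x)) by apply/funext.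
  have E2 : (fun n => f (g n.+1 x) ^+ 2) = (fun n => sign_pow p (g n.+1 x) ^+ 2).
    by apply/funext => n; rewrite fE.
  by rewrite -E1 -E2.
split => [beta1 b01|]; apply: filterS good => x [gM [g1 g2]].
  exact: mean_iterated_limit_averages.
exact: joint_iterated_limit_averages.
Qed.

(** The integral is an increment of the primitive over an interval of length [2 * mu] around
    [sigma], to which the mean value theorem applies; the interval of averaging has length
    [2 * sigma]. *)
Lemma mean_sign_pow_small (R : realType) (p mu sigma : R) :
  0 < p -> 0 < mu -> mu < sigma ->
  exists2 c : R, `|c - 1| <= mu / sigma &
    mean_sign_pow p (mu - sigma) (mu + sigma) = mu / sigma * (sigma `^ p * `|c| `^ p).
Proof.
move=> p0 m0 ms; have s0 : 0 < sigma by lra.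
have [|||c cI cE] := @MVT _ (norm_powR_primitive p) (fun x => `|x| `^ p) (sigma - mu) (sigma + mu).
- lra.
- move=> x; rewrite in_itv/= => /andP[x1 _].
  by apply: is_derive_norm_powR_primitive => //; rewrite gt_eqF//; lra.
- exact/continuous_subspaceT/continuous_norm_powR_primitive.
move: cI; rewrite in_itv/= => /andP[c1 c2].
(* The intermediate point is rescaled by [sigma], so that its distance to 1 is governed by
   [mu / sigma] alone. *)
exists (c / sigma).
  have -> : c / sigma - 1 = (c - sigma) / sigma by field; lra.
  rewrite normrM normfV [`|sigma|]gtr0_norm// ler_pM2r ?invr_gt0//.
  by rewrite ler_norml; apply/andP; split; lra.
have c0 : 0 < c by lra.
rewrite /mean_sign_pow Rintegral_truncated_sign_pow//; last by apply/andP; split; lra.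
rewrite opprB [mu + sigma]addrC cE -powRM ?normr_ge0 ?(ltW s0)//.
have -> : sigma * `|c / sigma| = `|c|.
  by rewrite normrM normfV (gtr0_norm s0) mulrC divfK// gt_eqF.
by field; apply/andP; split; lra.
Qed.

(** Factoring [sigma] out of both endpoint values isolates the leading term; the remaining average
    depends only on [p] and [mu / sigma] and tends to 1. *)
Lemma mean_sign_pow_sq_small (R : realType) (p mu sigma : R) :
  0 < p -> 0 < mu -> mu < sigma ->
  mean_sign_pow_sq p (mu - sigma) (mu + sigma) =
  (sigma `^ p / Num.sqrt (2 * p + 1)) ^+ 2 *
  (((1 + mu / sigma) `^ (2 * p + 1) + (1 - mu / sigma) `^ (2 * p + 1)) / 2).
Proof.
move=> p0 m0 ms; have s0 : 0 < sigma by lra.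
have q0 : 0 < 2 * p + 1 by lra.
rewrite /mean_sign_pow_sq Rintegral_truncated_sign_pow_sq//; last by apply/andP; split; lra.
rewrite opprB !norm_powR_primitive_gt0; [|lra|lra].
rewrite exprMn exprVn sqr_sqrtr ?(ltW q0)//.
have r1 : mu / sigma < 1 by rewrite ltr_pdivrMr// mul1r.
have r0 : 0 < mu / sigma by exact: divr_gt0.
have -> : mu + sigma = sigma * (1 + mu / sigma) by field; lra.
have -> : sigma - mu = sigma * (1 - mu / sigma) by field; lra.
rewrite !powRM; [|lra|lra|lra|lra].
have -> : sigma `^ (2 * p + 1) = (sigma `^ p) ^+ 2 * sigma.
  rewrite powRD; last by rewrite (gt_eqF s0) implybT.
  by rewrite powRr1 ?(ltW s0)// mulrC [2 * p]mulrC powRrM powR_mulrn ?powR_ge0// mulrC.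
move: (_ `^ (2 * p + 1)) (_ `^ (2 * p + 1)) (_ `^ p) => x y z.
have -> : sigma * (1 + mu / sigma) + sigma * (1 - mu / sigma) = 2 * sigma by field; lra.
by field; apply/andP; split; lra.
Qed.

(** Taken as the exact quotient minus 1, so that the formula for the limit is an algebraic identity
    for all positive [mu] and [sigma], and only its smallness needs [mu / sigma] small. *)
Definition relative_error (R : realType) (p eps mu sigma : R) : R :=
  mean_sign_pow p (mu - sigma) (mu + sigma) /
  (Num.sqrt (mean_sign_pow_sq p (mu - sigma) (mu + sigma)) + eps) *
  (1 / Num.sqrt (2 * p + 1) + eps / sigma `^ p) / (mu / sigma) - 1.

(** The bound is uniform in [i] and [e], which matters because [eps / sigma ^ p] is unbounded. As
    [b >= 1 / 2], the denominator is at least [(i + e) / 2], and the error in the numerator is at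
    most [2 * d * (i + e)]. *)
Lemma quotient_near1 (R : realType) (k b i e d : R) :
  0 < i -> 0 < e -> d <= 2^-1 -> `|k - 1| <= d -> `|b - 1| <= d ->
  `|k * (i + e) / (b * i + e) - 1| <= 4 * d.
Proof.
rewrite !ler_norml => i0 e0 d2 /andP[k1 k2] /andP[b1 b2].
have bi : (i + e) / 2 <= b * i + e.
  have : 2^-1 * i <= b * i by rewrite ler_pM2r//; lra.
  lra.
have bi0 : 0 < b * i + e by lra.
have -> : k * (i + e) / (b * i + e) - 1 =
    ((k - 1) * (i + e) + (1 - b) * i) / (b * i + e).
  by field; rewrite gt_eqF.
rewrite -ler_norml normrM normfV (gtr0_norm bi0) ler_pdivrMr//.
apply: (le_trans (ler_normD _ _)); rewrite !normrM (gtr0_norm i0).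
rewrite (gtr0_norm (addr_gt0 i0 e0)).
have d0 : 0 <= d by lra.
have k' : `|k - 1| * (i + e) <= d * (i + e).
  by rewrite ler_pM2r ?addr_gt0// ler_norml k1 k2.
have b' : `|1 - b| * i <= d * i.
  by rewrite ler_pM2r// ler_norml; apply/andP; split; lra.
nra.
Qed.

Lemma sqrt_near1 (R : realType) (b d : R) :
  0 <= b -> `|b - 1| <= d -> `|Num.sqrt b - 1| <= d.
Proof.
move=> b0; apply: le_trans.
have s0 : 0 <= Num.sqrt b by exact: sqrtr_ge0.
have -> : b - 1 = (Num.sqrt b - 1) * (Num.sqrt b + 1).
  by rewrite -[b in LHS]sqr_sqrtr//; ring.
rewrite normrM ler_peMr// ger0_norm; lra.
Qed.

Lemma norm_powR_near1 (R : realType) (q d : R) : 0 < q -> 0 < d ->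
  exists2 r : R, 0 < r & forall x, `|x - 1| < r -> `| `|x| `^ q - 1| <= d.
Proof.
move=> q0 d0.
have /cvgrPdist_le/(_ _ d0) := @continuous_norm_powR R q q0 1.
rewrite normr1 powR1 => /nbhs_ballP[r /= r0 rP].
exists r => // x xr; rewrite distrC.
by apply: rP; rewrite /ball/= distrC.
Qed.

Lemma relative_error_infinitesimal (R : realType) (p e : R) : 0 < p -> 0 < e ->
  exists r : R, 0 < r /\
    forall eps mu sigma : R, 0 < eps -> 0 < mu < 1 -> 0 < sigma < 1 ->
      mu / sigma < r -> `|relative_error p eps mu sigma| < e.
Proof.
(* The cap [1 / 2] is what [quotient_near1] requires, and [e / 8] makes its bound [4 * d] at most
   [e / 2]. *)
move=> p0 e0; pose d := Num.min 2^-1 (e / 8).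
have d0 : 0 < d by rewrite lt_min invr_gt0 divr_gt0// ltr0n.
have d2 : d <= 2^-1 by rewrite ge_min lexx.
have de : d <= e / 8 by rewrite ge_min lexx orbT.
have [r1 r10 r1P] := norm_powR_near1 p0 d0.
have q0 : 0 < 2 * p + 1 by lra.
have [r2 r20 r2P] := norm_powR_near1 q0 d0.
(* The threshold [1 / 2] forces [mu < sigma], [r1] controls the first moment and [r2] the second.
   None depends on [eps], [mu] or [sigma]. *)
exists (Num.min 2^-1 (Num.min r1 r2)); split; first by rewrite !lt_min r10 r20 invr_gt0 ltr0n.
move=> eps mu sigma eps0 /andP[m0 _] /andP[s0 _]; rewrite !lt_min => /and3P[rh rr1 rr2].
have r0 : 0 < mu / sigma by exact: divr_gt0.
have ms : mu < sigma by move: rh; rewrite ltr_pdivrMr//; lra.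
have [c cr AE] := mean_sign_pow_small p0 m0 ms.
have VE := mean_sign_pow_sq_small p0 m0 ms.
rewrite /relative_error AE VE.
set B := (_ / 2); set s := Num.sqrt (2 * p + 1); set z := sigma `^ p.
have s_gt0 : 0 < s by rewrite sqrtr_gt0.
have z0 : 0 < z by rewrite powR_gt0.
have pw x : 0 < x -> `|x - 1| < r2 -> `|x `^ (2 * p + 1) - 1| <= d.
  by move=> x0 /r2P; rewrite (gtr0_norm x0).
have B0 : 0 <= B by rewrite divr_ge0// addr_ge0// powR_ge0.
have B1 : `|B - 1| <= d.
  have h1 : `|(1 + mu / sigma) `^ (2 * p + 1) - 1| <= d.
    by apply: pw; [lra|rewrite addrAC subrr add0r gtr0_norm].
  have h2 : `|(1 - mu / sigma) `^ (2 * p + 1) - 1| <= d.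
    by apply: pw; [lra|rewrite addrAC subrr add0r normrN gtr0_norm].
  move: h1 h2; rewrite /B !ler_norml => /andP[h1 h1'] /andP[h2 h2'].
  by apply/andP; split; lra.
rewrite sqrtrM ?sqr_ge0// sqrtr_sqr (gtr0_norm (divr_gt0 z0 s_gt0)).
have k1 : `| `|c| `^ p - 1| <= d by apply: r1P; exact: le_lt_trans cr rr1.
have := @quotient_near1 _ (`|c| `^ p) (Num.sqrt B) s^-1 (eps / z) d.
rewrite invr_gt0 divr_gt0// => /(_ s_gt0 isT d2 k1 (sqrt_near1 B0 B1)).
move: (Num.sqrt B) (sqrtr_ge0 B) (`|c| `^ p) => b b0 k.
(* The scale [z] now cancels against the first moment, which leaves the shape of [quotient_near1]
   with [i = 1 / s] and [e = eps / z]. *)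
have -> : z / s * b + eps = z * (b / s + eps / z).
  by field; rewrite !gt_eqF.
have D0 : 0 < b / s + eps / z.
  by rewrite ltr_wpDl ?divr_gt0// divr_ge0// ltW.
move: D0; move: (b / s + eps / z) => D D0; move: (eps / z) => x.
have -> : mu / sigma * (z * k) / (z * D) * (1 / s + x) / (mu / sigma) =
    k * (s^-1 + x) / D.
  by field; rewrite !gt_eqF.
by move=> h; apply: (le_lt_trans h); lra.
Qed.

Unset Implicit Arguments.
Set Strict Implicit.

Theorem proposition5p3 (R : realType) :
  (exists o1 : R -> R -> R -> R -> R,
    (forall p : R, 0 < p -> forall e : R, 0 < e ->
      exists r : R, 0 < r /\
        forall eps mu sigma : R, 0 < eps -> 0 < mu < 1 -> 0 < sigma < 1 ->
          mu / sigma < r -> `|o1 p eps mu sigma| < e) /\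
    (forall (p eps mu sigma : R)
        (d : measure_display) (T : measurableType d) (P : probability T R)
        (g : nat -> {RV P >-> R}),
      0 < p -> 0 < eps -> 0 < mu < 1 -> 0 < sigma < 1 ->
      iid_uniform (fun t => g t.+1) (mu - sigma) (mu + sigma) ->
      let u := mu / sigma *
        ((1 + o1 p eps mu sigma) /
         (1 / Num.sqrt (2 * p + 1) + eps / sigma `^ p)) in
      (forall beta1 : R, 0 < beta1 < 1 ->
        {ae P, forall x, mean_iterated_limit beta1 p eps (fun t => g t x) u}) /\
      {ae P, forall x, joint_iterated_limit p eps (fun t => g t x) u})) /\
  (forall sigma0 : R, 0 < sigma0 < 1 ->
    exists c C : R, 0 < c /\ 0 < C /\
      forall eps mu sigma : R,
        0 < eps -> 0 < mu < 1 -> 0 < sigma <= sigma0 ->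
        eps * ln (1 / sigma) < 1 ->
        exists pstar : R,
          [/\ 0 < pstar,
              (forall p q : R, 0 < p -> p < q -> q < pstar ->
                 utilde mu sigma eps p < utilde mu sigma eps q),
              (forall p q : R, pstar < p -> p < q ->
                 utilde mu sigma eps q < utilde mu sigma eps p) &
              c * (ln (eps * ln (1 / sigma)) / ln sigma) <= pstar <=
              C * (ln (eps * ln (1 / sigma)) / ln sigma)]).
Proof.
split; last exact: optimal_power_bounds.
exists (@relative_error R); split; first by move=> p p0 e; exact: relative_error_infinitesimal.
move=> p eps mu sigma d T P g p0 e0 /andP[m0 _] /andP[s0 _] iid u.
(* By the choice of the error term, the claimed expression is the exact limit once the nonzero
   factors [mu / sigma] and the denominator cancel. *)
have -> : u = mean_sign_pow p (mu - sigma) (mu + sigma) /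
    (Num.sqrt (mean_sign_pow_sq p (mu - sigma) (mu + sigma)) + eps).
  rewrite /u /relative_error addrC subrK.
  have t0 : 0 < 1 / Num.sqrt (2 * p + 1) + eps / sigma `^ p.
    by rewrite addr_gt0// divr_gt0 ?powR_gt0// sqrtr_gt0; lra.
  have r0 : 0 < mu / sigma by exact: divr_gt0.
  move: t0; move: (1 / _ + _) => t t0; move: r0; move: (mu / sigma) => r r0.
  move: (mean_sign_pow _ _ _ / _) => v.
  by field; rewrite !gt_eqF.
by apply: almost_sure_limits => //; lra.
Qed.
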